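(* Let $\Gamma$ be the infinite metric graph obtained by gluing the finite graphs $\Gamma_1,\Gamma_2,\Gamma_3,\dots$ in a chain, and let $\overline{T}$ be the infinite rooted binary tree, regarded as a metric graph, both as defined in the context. Then: (1) $\overline{T}$ does not admit a coarse embedding into $\Gamma$; (2) $\Gamma$ does not admit a coarse embedding into $\overline{T}$.
   Context: Graphs are regarded as metric spaces (with edges included as segments of length 1) equipped with the path metric. The graphs $\Gamma_n$. $\Gamma_0$ is a single edge of length $1$; its two endpoints form its pair of primary vertices. Given $\Gamma_n$, take four copies of it, indexed by $i=0,1,2,3$; in the $i$-th copy let $p_i,q_i$ be a pair of primary vertices, i.e. a pair of vertices of valence $2^n$ in $\Gamma_n$ at distance $2^n$ from each other (the same pair in each copy). $\Gamma_{n+1}$ is obtained by identifying $q_i$ with $p_{i+1}$ for all $i$ modulo $4$, and is equipped with the path metric. (So $\Gamma_1$ is a 4-cycle; for $n\ge 1$, $\Gamma_n$ has exactly two pairs of primary vertices, namely the two pairs of opposite vertices among the four gluing vertices, and $\operatorname{diam}\Gamma_n=2^n$.) The graph $\Gamma$. For each $n\ge 1$ let $p_n,q_n$ be a pair of primary vertices of $\Gamma_n$. $\Gamma$ is obtained from the disjoint union of the $\Gamma_n$ by identifying $q_n$ with $p_{n+1}$ for every $n$, with the path metric: for $x\in\Gamma_m$, $y\in\Gamma_n$ with $m<n$, $d_\Gamma(x,y)=d_{\Gamma_m}(x,q_m)+\sum_{m<k<n}2^k+d_{\Gamma_n}(p_n,y)$, and $d_\Gamma=d_{\Gamma_n}$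 on $\Gamma_n$. The tree $\overline{T}$. Let $\Omega_i=\{-1,1\}^i$ for $i\ge 0$ ($\Omega_0$ consists of the empty sequence, the root), $T_n=\bigcup_{i\le n}\Omega_i$ and $T=\bigcup_{j\ge1}T_j$. $\overline{T}$ is the graph with vertex set $T$ in which each $\sigma\in\Omega_i$ is joined by an edge of length $1$ to its two extensions $(\sigma,-1),(\sigma,1)\in\Omega_{i+1}$, with the path metric. Coarse embedding: a map $f\colon X\to Y$ between metric spaces for which there exist non-decreasing functions $\rho_-,\rho_+\colon[0,\infty)\to[0,\infty)$ with $\lim_{t\to\infty}\rho_-(t)=\infty$ and $\rho_-(d_X(x,y))\le d_Y(f(x),f(y))\le\rho_+(d_X(x,y))$ for all $x,y\in X$. *)

(* Defs.v *)
From HB Require Import structures.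
From mathcomp Require Import all_boot all_order all_algebra.
From mathcomp Require Import all_classical all_reals topology normedtype lra.

Set Implicit Arguments.
Unset Strict Implicit.
Unset Printing Implicit Defensive.

Import Order.TTheory GRing.Theory Num.Theory.
Import numFieldNormedType.Exports.

Local Open Scope classical_set_scope.
Local Open Scope ring_scope.

Inductive linked (V E : Type) (a b : E -> V) (u : V) : V -> Prop :=
| linked_refl : linked a b u u
| linked_fwd e : linked a b u (a e) -> linked a b u (b e)
| linked_bwd e : linked a b u (b e) -> linked a b u (a e).

(* A connected graph. The orientation of an edge only serves to parametrize it
   by the unit interval. *)
Record graph := Graph {
  vert : choiceType;
  edge : choiceType;
  org : edge -> vert;
  dst : edge -> vert;
  graph_connected : forall u v : vert, linked org dst u v
}.

Record pgraph := PGraph {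
  graph_of :> graph;
  ppt : vert graph_of;
  qpt : vert graph_of;
  ppt_neq_qpt : ppt != qpt
}.

Section linked_theory.
Variables (V E : Type) (a b : E -> V).

Lemma linked_trans u v w :
  linked a b u v -> linked a b v w -> linked a b u w.
Proof.
move=> uv; elim=> [//|e _ IH|e _ IH]; [exact: linked_fwd|exact: linked_bwd].
Qed.

Lemma linked_sym u v : linked a b u v -> linked a b v u.
Proof.
elim=> [|e _ IH|e _ IH]; first exact: linked_refl.
- apply: linked_trans IH; exact/linked_bwd/linked_refl.
- apply: linked_trans IH; exact/linked_fwd/linked_refl.
Qed.

End linked_theory.

(* The points of a metric graph: its vertices and, for each edge, the points
   at parameter 0 < t < 1. *)
Definition metric_graph (R : realType) (G : graph) : Type :=
  (vert G + edge G * {t : R | 0 < t < 1})%type.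

HB.instance Definition _ (R : realType) (G : graph) :=
  Choice.copy (metric_graph R G)
    (vert G + edge G * {t : R | 0 < t < 1})%type.

Section metric_graph.
Variables (R : realType) (G : graph).
Implicit Types (x y z : metric_graph R G) (e : edge G) (s t l : R).

Definition on_vert (v : vert G) : metric_graph R G := inl v.

Definition on_edge e t : metric_graph R G :=
  if insub t is Some u then inr (e, u)
  else if t <= 0 then on_vert (org e) else on_vert (dst e).

(* [polyline x y l]: there is a path of length l from x to y which is a
   concatenation of finitely many segments, each inside a closed edge. *)
Inductive polyline x : metric_graph R G -> R -> Prop :=
| polyline_nil : polyline x x 0
| polyline_cons e s t l : 0 <= s <= 1 -> 0 <= t <= 1 ->
    polyline x (on_edge e s) l -> polyline x (on_edge e t) (l + `|s - t|).

Definition path_dist x y : R := inf [set l | polyline x y l].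

Lemma on_edge0 e : on_edge e 0 = on_vert (org e).
Proof. by rewrite /on_edge insubN ?lexx// ltxx. Qed.

Lemma on_edge1 e : on_edge e 1 = on_vert (dst e).
Proof. by rewrite /on_edge insubN ?ltxx ?andbF// ler10. Qed.

Lemma on_edge_in e (u : {t : R | 0 < t < 1}) : on_edge e (val u) = inr (e, u).
Proof. by rewrite /on_edge valK. Qed.

Lemma polyline_ge0 x y l : polyline x y l -> 0 <= l.
Proof. by elim=> // e s t k _ _ _ k0; rewrite addr_ge0. Qed.

Lemma polyline_trans x y z l k :
  polyline x y l -> polyline y z k -> polyline x z (l + k).
Proof.
move=> xy; elim=> [|e s t m s01 t01 _ IH]; first by rewrite addr0.
by rewrite addrA; apply: polyline_cons.
Qed.

Lemma polyline_seg e s t : 0 <= s <= 1 -> 0 <= t <= 1 ->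
  polyline (on_edge e s) (on_edge e t) `|s - t|.
Proof.
by move=> s01 t01; rewrite -[`|_|]add0r; apply: polyline_cons => //;
  exact: polyline_nil.
Qed.

Lemma polyline_sym x y l : polyline x y l -> polyline y x l.
Proof.
elim=> [|e s t k s01 t01 _ IH]; first exact: polyline_nil.
by rewrite addrC distrC; apply: polyline_trans IH; apply: polyline_seg.
Qed.

Lemma polyline_lipschitz (f : metric_graph R G -> R) x y l :
  (forall e s t, 0 <= s <= 1 -> 0 <= t <= 1 ->
     `|f (on_edge e s) - f (on_edge e t)| <= `|s - t|) ->
  polyline x y l -> `|f x - f y| <= l.
Proof.
move=> flip; elim=> [|e s t k s01 t01 _ IH]; first by rewrite subrr normr0.
rewrite (le_trans (ler_distD (f (on_edge e s)) _ _))// lerD//.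
exact: flip.
Qed.

Lemma polyline_vert (u v : vert G) :
  exists l, polyline (on_vert u) (on_vert v) l.
Proof.
elim: (graph_connected u v) => [|e _ [l ul]|e _ [l ul]].
- by exists 0; exact: polyline_nil.
- exists (l + `|0 - 1|); rewrite -on_edge1; apply: polyline_cons;
    by rewrite ?lexx ?ler01// on_edge0.
- exists (l + `|1 - 0|); rewrite -on_edge0; apply: polyline_cons;
    by rewrite ?lexx ?ler01// on_edge1.
Qed.

Lemma polyline_to_vert x : exists v l, polyline x (on_vert v) l.
Proof.
case: x => [v|[e u]]; first by exists v, 0; exact: polyline_nil.
exists (org e), `|val u - 0|; rewrite -on_edge0 -on_edge_in.
by have /andP[u0 u1] := valP u; apply: polyline_seg;
  rewrite ?lexx ?ler01// !ltW.
Qed.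

Lemma polyline_exists x y : exists l, polyline x y l.
Proof.
have [u [k xu]] := polyline_to_vert x; have [v [m yv]] := polyline_to_vert y.
have [l uv] := polyline_vert u v.
exists (k + l + m); apply: polyline_trans (polyline_sym yv).
exact: polyline_trans xu uv.
Qed.

Lemma path_dist_le x y l : polyline x y l -> path_dist x y <= l.
Proof.
move=> xy; apply: ge_inf => //; exists 0 => k; exact: polyline_ge0.
Qed.

Lemma path_dist_ge x y l :
  (forall k, polyline x y k -> l <= k) -> l <= path_dist x y.
Proof.
move=> lxy; apply: lb_le_inf; last by move=> k /lxy.
exact: polyline_exists.
Qed.

Lemma path_distxx x : path_dist x x = 0.
Proof.
apply/eqP; rewrite eq_le path_dist_le ?path_dist_ge//; last exact: polyline_nil.
by move=> k; exact: polyline_ge0.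
Qed.

Lemma path_dist_sym x y : path_dist x y = path_dist y x.
Proof.
by congr inf; apply/seteqP; split => l /=; exact: polyline_sym.
Qed.

Lemma path_dist_triangle y x z :
  path_dist x z <= path_dist x y + path_dist y z.
Proof.
rewrite -lerBlDr; apply: path_dist_ge => k xy.
rewrite lerBlDr addrC -lerBlDr; apply: path_dist_ge => l yz.
by rewrite lerBlDr addrC; apply: path_dist_le; exact: polyline_trans xy yz.
Qed.

Lemma path_dist_lipschitz (f : metric_graph R G -> R) x y :
  (forall e s t, 0 <= s <= 1 -> 0 <= t <= 1 ->
     `|f (on_edge e s) - f (on_edge e t)| <= `|s - t|) ->
  `|f x - f y| <= path_dist x y.
Proof. by move=> flip; apply: path_dist_ge => k; exact: polyline_lipschitz. Qed.

Lemma on_edgeP (P : R -> metric_graph R G -> Prop) e :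
  P 0 (on_vert (org e)) -> P 1 (on_vert (dst e)) ->
  (forall u : {t : R | 0 < t < 1}, P (val u) (inr (e, u))) ->
  forall s, 0 <= s <= 1 -> P s (on_edge e s).
Proof.
move=> P0 P1 Pu s /andP[]; rewrite le_eqVlt => /orP[/eqP <- _|s0].
  by rewrite on_edge0.
rewrite le_eqVlt => /orP[/eqP ->|s1]; first by rewrite on_edge1.
have s01 : 0 < s < 1 by rewrite s0 s1.
by have := Pu (Sub s s01); rewrite -on_edge_in.
Qed.

Lemma max0_lipschitz (a b : R) : `|Num.max 0 a - Num.max 0 b| <= `|a - b|.
Proof.
rewrite ler_norml; case: (lerP b a) => ?;
  case: (leP 0 a) => ?; case: (leP 0 b) => ?; apply/andP; split; lra.
Qed.

Lemma path_dist_inner_gt0 e (u : {t : R | 0 < t < 1}) y :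
  inr (e, u) <> y -> 0 < path_dist (inr (e, u)) y.
Proof.
have /andP[u0 u1] := valP u.
pose c : R := val u; pose r := Num.min c (1 - c).
pose F e' (s : R) : R := if e' == e then Num.max 0 (r - `|s - c|) else 0.
pose f (z : metric_graph R G) :=
  if z is inr (e', w) then F e' (val w) else 0.
have r0 : 0 < r by rewrite /r lt_min u0 subr_gt0.
have [rc rc1] : r <= c /\ r <= 1 - c by rewrite /r !ge_min !lexx orbT.
have fE e' s : 0 <= s <= 1 -> f (on_edge e' s) = F e' s.
  move: s; apply: (@on_edgeP (fun s z => f z = F e' s)) => //=; rewrite /F;
    case: eqP => // _; rewrite max_l// subr_le0.
    by rewrite sub0r normrN ger0_norm// ltW.
  by rewrite ger0_norm// subr_ge0 ltW.
move=> xy; apply: (@lt_le_trans _ _ `|f (inr (e, u)) - f y|); last first.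
  apply: path_dist_lipschitz => e' s t s01 t01; rewrite !fE// /F.
  case: eqP => _; last by rewrite subrr normr0.
  apply: le_trans (max0_lipschitz _ _) _.
  rewrite opprB addrC addrA subrK (le_trans (ler_dist_dist _ _))//.
  by rewrite opprB addrA subrK distrC.
have -> : f (inr (e, u)) = r.
  by rewrite /f /F eqxx subrr normr0 subr0 max_r// ltW.
rewrite normr_gt0 subr_eq0; case: y xy => [v _ /=|[e' w] xy /=].
  by rewrite gt_eqF.
rewrite /F; have [ee'|_] := eqVneq e' e; last by rewrite gt_eqF.
have wu : val w != c.
  by apply/eqP => /val_inj wu; apply: xy; rewrite ee' wu.
rewrite gt_eqF// gt_max r0/= ltrBlDr ltrDl normr_gt0 subr_eq0//.
Qed.

Lemma path_dist_vert_gt0 v y : on_vert v <> y -> 0 < path_dist (on_vert v) y.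
Proof.
have half : 0 < 2^-1 :> R by rewrite invr_gt0.
have half1 : 1 - 2^-1 = 2^-1 :> R by lra.
pose F e' (s : R) : R := (if org e' == v then Num.max 0 (2^-1 - s) else 0)
  + (if dst e' == v then Num.max 0 (s - 2^-1) else 0).
pose f (z : metric_graph R G) : R :=
  match z with inl w => if w == v then 2^-1 else 0
             | inr (e', w) => F e' (val w) end.
have fE e' s : 0 <= s <= 1 -> f (on_edge e' s) = F e' s.
  move: s; apply: (@on_edgeP (fun s z => f z = F e' s)) => //=; rewrite /F.
    rewrite subr0 sub0r (max_r (ltW half)) max_l ?oppr_le0 ?ltW//.
    by case: (dst e' == v); rewrite addr0.
  rewrite half1 (max_r (ltW half)) max_l; last by lra.
  by case: (org e' == v); rewrite add0r.
move=> xy; apply: (@lt_le_trans _ _ `|f (on_vert v) - f y|); last first.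
  apply: path_dist_lipschitz => e' s t s01 t01; rewrite !fE// /F {xy f F fE}.
  case: eqP => _; case: eqP => _; rewrite ?addr0 ?add0r ?oppr0 ?subrr ?normr0//.
  - case: (leP 0 (2^-1 - s)); case: (leP 0 (s - 2^-1));
    case: (leP 0 (2^-1 - t)); case: (leP 0 (t - 2^-1));
    case: (lerP t s) => ? ? ? ? ?;
      rewrite ler_norml; apply/andP; split; lra.
  - apply: le_trans (max0_lipschitz _ _) _.
    by rewrite opprB addrC addrA subrK distrC.
  - apply: le_trans (max0_lipschitz _ _) _.
    by rewrite opprB addrA subrK.
rewrite normr_gt0 subr_eq0 /= eqxx; case: y xy => [w /= xy|[e' w] xy /=].
  have [wv|_] := eqVneq w v; last by rewrite gt_eqF.
  by exfalso; apply: xy; rewrite wv.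
rewrite gt_eqF// /F; case: w {xy f F fE} => c /= /andP[c0 c1].
move: (org e' == v) (dst e' == v) => [] [];
  case: (leP 0 (2^-1 - c)); case: (leP 0 (c - 2^-1)) => ? ?; lra.
Qed.

Lemma path_dist_positivity x y : path_dist x y = 0 -> x = y.
Proof.
move=> xy0; apply: contrapT => xy; suff : 0 < path_dist x y by rewrite xy0 ltxx.
case: x xy {xy0} => [v|[e u]]; first exact: path_dist_vert_gt0.
exact: path_dist_inner_gt0.
Qed.

HB.instance Definition _ := @isMetric.Build R (metric_graph R G)
  path_dist path_distxx path_dist_positivity path_dist_sym
  path_dist_triangle.

End metric_graph.

(* [glue next G] is the disjoint union of the graphs [G i] with [qpt (G i)]
   identified with [ppt (G (next i))] for every i. The class
   {qpt (G i), ppt (G (next i))} is represented by ppt (G (next i)), so the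
   vertices of the quotient are those of the disjoint union that are not a
   [qpt]. The last two arguments ensure that the quotient is connected. *)
Section glue.
Variables (I : choiceType) (next : I -> I) (G : I -> pgraph).
Variables (i0 : I) (next_reach : forall i, exists k, i = iter k next i0).

Let sum_vert : choiceType := {i : I & vert (G i)}.

Definition glue_rep (x : sum_vert) : bool := tagged x != qpt (G (tag x)).

Definition glue_vert : choiceType := {x : sum_vert | glue_rep x}.

Definition glue_repr (x : sum_vert) : sum_vert :=
  if glue_rep x then x
  else Tagged (fun i => vert (G i)) (ppt (G (next (tag x)))).

Lemma glue_reprP x : glue_rep (glue_repr x).
Proof. by rewrite /glue_repr; case: ifP => // _; exact: ppt_neq_qpt. Qed.

Definition glue_class (i : I) (v : vert (G i)) : glue_vert :=
  exist glue_rep _ (glue_reprP (Tagged (fun i => vert (G i)) v)).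

Definition glue_edge : choiceType := {i : I & edge (G i)}.

Definition glue_org (e : glue_edge) : glue_vert := glue_class (org (tagged e)).

Definition glue_dst (e : glue_edge) : glue_vert := glue_class (dst (tagged e)).

Lemma glue_class_qpt i :
  glue_class (qpt (G i)) = glue_class (ppt (G (next i))).
Proof.
apply: val_inj; rewrite /= /glue_repr /glue_rep /= eqxx /=.
by rewrite ppt_neq_qpt.
Qed.

Lemma glue_class_linked i (u v : vert (G i)) :
  linked glue_org glue_dst (glue_class u) (glue_class v).
Proof.
elim: (graph_connected u v) => [|e _ IH|e _ IH]; first exact: linked_refl.
- exact: (@linked_fwd _ _ glue_org glue_dst _ (Tagged (fun i => edge (G i)) e)).
- exact: (@linked_bwd _ _ glue_org glue_dst _ (Tagged (fun i => edge (G i)) e)).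
Qed.

Lemma glue_connected (u v : glue_vert) : linked glue_org glue_dst u v.
Proof.
suff h w : linked glue_org glue_dst (glue_class (ppt (G i0))) w.
  exact: linked_trans (linked_sym (h u)) (h v).
have hp i : linked glue_org glue_dst (glue_class (ppt (G i0)))
                                     (glue_class (ppt (G i))).
  have [k ->] := next_reach i; elim: k => [|k IH] /=; first exact: linked_refl.
  rewrite -glue_class_qpt; apply: linked_trans IH _; exact: glue_class_linked.
case: w => -[i w] wP; apply: linked_trans (hp i) _.
have -> : exist glue_rep (existT _ i w) wP = glue_class w :> glue_vert.
  by apply: val_inj; rewrite /= /glue_repr wP.
exact: glue_class_linked.
Qed.

Definition glue : graph := Graph glue_connected.

End glue.

Lemma interval_connected (u v : bool) :
  linked (fun _ : unit => false) (fun _ : unit => true) u v.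
Proof.
suff h w : linked (fun _ : unit => false) (fun _ : unit => true) false w.
  exact: linked_trans (linked_sym (h u)) (h v).
by case: w; [exact: (linked_fwd (e := tt) (linked_refl _ _ _))|
             exact: linked_refl].
Qed.

Definition interval : graph := Graph interval_connected.

Lemma ordS4_reach (i : 'I_4) : exists k, i = iter k (@ordS 4) ord0.
Proof. by exists i; apply: val_inj; case: i => -[|[|[|[|]]]]. Qed.

Definition four_cycle (G : pgraph) : graph :=
  glue (fun _ : 'I_4 => G) ordS4_reach.

(* The image in [four_cycle G] of the vertex p_i of the i-th copy of G. *)
Definition four_cycle_pt (G : pgraph) (i : 'I_4) : vert (four_cycle G) :=
  glue_class (@ordS 4) (G := fun _ => G) (i := i) (ppt G).

Definition i0_4 : 'I_4 := @Ordinal 4 0 isT.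
Definition i2_4 : 'I_4 := @Ordinal 4 2 isT.

Lemma four_cycle_pt_neq (G : pgraph) :
  four_cycle_pt G i0_4 != four_cycle_pt G i2_4.
Proof.
apply/eqP => /(congr1 (fun x => tag (val x))) /=.
by rewrite /glue_repr /glue_rep /= ppt_neq_qpt.
Qed.

(* The graph Gamma_n with one of its pairs of primary vertices: for n >= 1, the
   opposite gluing vertices p_0 and p_2. A cyclic permutation of the four
   copies is an automorphism of Gamma_n, and these automorphisms carry
   (p_0, p_2) to any other (ordered) pair of primary vertices. *)
Fixpoint Gamma_ (n : nat) : pgraph :=
  if n is m.+1 then PGraph (four_cycle_pt_neq (Gamma_ m))
  else @PGraph interval false true isT.

Lemma succn_reach (n : nat) : exists k, n = iter k succn 0%N.
Proof. by exists n; elim: n => //= n <-. Qed.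

Definition Gamma_graph : graph := glue (fun n => Gamma_ n.+1) succn_reach.

Definition Gamma (R : realType) : metricType R := metric_graph R Gamma_graph.

(* The elements of {-1, 1} are encoded as booleans; the edge (s, b) joins s to
   its extension by b. *)
Lemma binary_tree_connected (u v : seq bool) :
  linked (fun e : seq bool * bool => e.1) (fun e => rcons e.1 e.2) u v.
Proof.
suff h w :
    linked (fun e : seq bool * bool => e.1) (fun e => rcons e.1 e.2) [::] w.
  exact: linked_trans (linked_sym (h u)) (h v).
elim/last_ind: w => [|w b IH]; first exact: linked_refl.
exact: (@linked_fwd _ _ (fun e : seq bool * bool => e.1) _ _ (w, b)).
Qed.

Definition binary_tree : graph := Graph binary_tree_connected.

Definition Tbar (R : realType) : metricType R := metric_graph R binary_tree.

Definition coarse_embedding (R : realType) (X Y : metricType R) (f : X -> Y) :=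
  exists rho_m rho_p : R -> R,
    [/\ (forall t, 0 <= t -> 0 <= rho_m t) /\ (forall t, 0 <= t -> 0 <= rho_p t),
        {in >= 0 &, {homo rho_m : s t / s <= t}} /\
        {in >= 0 &, {homo rho_p : s t / s <= t}},
        rho_m t @[t --> +oo] --> +oo &
        forall x y, rho_m (mdist x y) <= mdist (f x) (f y) <= rho_p (mdist x y)].

(* Main.v *)
(** A set of vertices whose boundary edges all meet one or two vertices [a], [c]
  is at least as far from its complement as from [a] or [c]: the distance to
  {a, c} on the set, extended by 0, is 1-Lipschitz. Up to moving images to
  nearby vertices, an embedding is a coarse map g between vertex sets.

  (1) Every gluing vertex q_n of Gamma cuts off a bounded part, so g must send
  points of both rays (-1, -1, ...) and (1, 1, ...) near q_n. These points are
  then at bounded distance from each other, hence from the root, so q_n stays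
  at bounded distance from the image of the root for all large n: absurd.

  (2) Two far apart points of the tree are separated by a vertex w far from
  both. Apply this to the images of the primary vertices a, c of Gamma_(n+1):
  each of the two halves of Gamma_(n+1) joining a to c has a point sent near w.
  These two points are at bounded distance from each other, hence the first one
  from {a, c}, which brings w near g a or g c. *)

Require Import Defs.
From mathcomp Require Import all_boot all_order all_algebra.
From mathcomp Require Import all_classical all_reals topology normedtype.
From mathcomp Require Import lra zify.

Set Implicit Arguments.
Unset Strict Implicit.
Unset Printing Implicit Defensive.

Import Order.TTheory GRing.Theory Num.Theory.
Import numFieldNormedType.Exports.

Local Open Scope classical_set_scope.
Local Open Scope ring_scope.

(** * Crossing a border along a path, and the Archimedean property *)

Lemma linked_cross (V E : Type) (a b : E -> V) (P : pred V) u v :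
  linked a b u v -> P u != P v -> exists e, P (a e) != P (b e).
Proof.
elim=> [|e _ IH|e _ IH]; first by rewrite eqxx.
- by have [/IH//|/negPn/eqP -> ?] := boolP (P u != P (a e)); exists e.
- have [/IH//|/negPn/eqP -> ?] := boolP (P u != P (b e)); exists e.
  by rewrite eq_sym.
Qed.

Lemma exists_nat_gt (R : realType) (x : R) : exists n : nat, x < n%:R.
Proof.
exists (Num.bound `|x|); apply: le_lt_trans (ler_norm x) _.
exact: archi_boundP.
Qed.

(** * Vertex distances and cut vertices *)

Section vertex_distance.
Variables (R : realType) (G : graph).
Implicit Types (u v w : vert G) (e : edge G) (phi : vert G -> R).

Definition vdist u v : R := path_dist (on_vert R u) (on_vert R v).

Definition edge_lipschitz phi :=
  forall e, `|phi (org e) - phi (dst e)| <= 1.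

Lemma vdistxx u : vdist u u = 0.
Proof. exact: path_distxx. Qed.

Lemma vdist_sym u v : vdist u v = vdist v u.
Proof. exact: path_dist_sym. Qed.

Lemma vdist_triangle v u w : vdist u w <= vdist u v + vdist v w.
Proof. exact: path_dist_triangle. Qed.

Lemma vdist_ge0 u v : 0 <= vdist u v.
Proof. by apply: path_dist_ge => k; exact: polyline_ge0. Qed.

Lemma vdist_edge e : vdist (org e) (dst e) <= 1.
Proof.
rewrite /vdist -on_edge0 -on_edge1; apply: path_dist_le.
by rewrite -[X in polyline _ _ X](normrN1 R) -[- 1]sub0r;
  apply: polyline_seg; rewrite ?lexx ?ler01.
Qed.

(* A function on the vertices is extended affinely to the edges. *)
Lemma edge_lipschitz_vdist phi u v :
  edge_lipschitz phi -> `|phi u - phi v| <= vdist u v.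
Proof.
move=> phiL.
pose F e (s : R) : R := (1 - s) * phi (org e) + s * phi (dst e).
pose f (z : metric_graph R G) : R :=
  match z with inl w => phi w | inr (e, s) => F e (val s) end.
have fE e s : 0 <= s <= 1 -> f (on_edge e s) = F e s.
  by move: s; apply: (@on_edgeP _ _ (fun s z => f z = F e s)) => //=;
    rewrite /F; lra.
apply: (@path_dist_lipschitz R G f (on_vert R u) (on_vert R v)) => e s t s01 t01; rewrite !fE//.
have -> : F e s - F e t = (phi (org e) - phi (dst e)) * (t - s).
  by rewrite /F; lra.
by rewrite normrM (distrC s t) ler_piMl.
Qed.

Lemma edge_lipschitz_vdist_le u v phi :
  edge_lipschitz phi -> phi v - phi u <= vdist u v.
Proof.
move=> /(@edge_lipschitz_vdist phi u v); apply: le_trans.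
by rewrite distrC ler_norm.
Qed.

Lemma cut_vdist (S : pred (vert G)) a c u v :
  (forall e, S (org e) != S (dst e) ->
     [\/ org e = a, org e = c, dst e = a | dst e = c]) ->
  S u -> ~~ S v -> vdist u a <= vdist u v \/ vdist u c <= vdist u v.
Proof.
move=> cutS Su Sv.
pose m x := Num.min (vdist x a) (vdist x c).
pose phi x : R := if S x then m x else 0.
have mdst x y : vdist x y <= 1 -> m x - m y <= 1.
  move=> xy1; have := vdist_triangle y x a; have := vdist_triangle y x c.
  rewrite /m; case: (leP (vdist y a) (vdist y c)) => ?;
    by case: (leP (vdist x a) (vdist x c)) => ?; lra.
have m_ge0 x : 0 <= m x by rewrite /m le_min !vdist_ge0.
have m0 x : x = a \/ x = c -> m x = 0.
  move=> xac; apply/eqP; rewrite eq_le m_ge0 andbT /m ge_min.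
  by case: xac => ->; rewrite vdistxx lexx ?orbT.
have phiL : edge_lipschitz phi.
  move=> e; have e1 := vdist_edge e.
  have e1' : vdist (dst e) (org e) <= 1 by rewrite vdist_sym.
  have := mdst _ _ e1; have := mdst _ _ e1'; rewrite ler_norml /phi.
  have := m_ge0 (org e); have := m_ge0 (dst e).
  (* On an edge leaving [S], [m] vanishes at one end and is at most 1 at the other, so truncation to
     0 keeps the jump of [phi] at most 1. *)
  have : S (org e) != S (dst e) -> m (org e) = 0 \/ m (dst e) = 0.
    by move=> /cutS[] /=; [left|left|right|right]; apply: m0; tauto.
  case: (S (org e)); case: (S (dst e)) => h; move=> *; try (apply/andP; lra).
  - by have [] := h isT => ?; apply/andP; lra.
  - by have [] := h isT => ?; apply/andP; lra.
have := edge_lipschitz_vdist_le v u phiL.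
rewrite /phi Su (negbTE Sv) subr0 vdist_sym /m ge_min => /orP[]; tauto.
Qed.

Lemma cut1_vdist (S : pred (vert G)) a u v :
  (forall e, S (org e) != S (dst e) -> org e = a \/ dst e = a) ->
  S u -> ~~ S v -> vdist u a <= vdist u v.
Proof.
move=> cutS Su Sv.
suff : vdist u a <= vdist u v \/ vdist u a <= vdist u v by case.
by apply: cut_vdist Su Sv => e /cutS[]; [exact: Or41|exact: Or43].
Qed.

End vertex_distance.

(** * From coarse embeddings to maps of vertices *)

Section vertex_maps.
Variable R : realType.

(** Not literally nearest: an interior point of an edge goes to the origin of that edge. Distance at
    most 1 suffices. *)
Definition nearest_vert (G : graph) (x : metric_graph R G) : vert G :=
  match x with inl v => v | inr (e, _) => org e end.

Lemma nearest_vert_dist (G : graph) (x : metric_graph R G) :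
  path_dist x (on_vert R (nearest_vert x)) <= 1.
Proof.
case: x => [v|[e s]] /=; first by rewrite path_distxx.
have /andP[s0 s1] := valP s.
rewrite -on_edge0 -on_edge_in; apply: (@le_trans _ _ `|val s - 0|).
  by apply: path_dist_le; apply: polyline_seg; rewrite ?lexx ?ler01 ?(ltW s0) ?ltW.
by rewrite subr0 gtr0_norm// ltW.
Qed.

(** Rounding the images to vertices moves each by at most 1, so distances change by at most 2;
    [rho_p] gives the first bound and the divergence of [rho_m] the second. *)
Lemma coarse_embedding_vert (G H : graph)
    (f : (metric_graph R G : metricType R) -> (metric_graph R H : metricType R)) :
  coarse_embedding f -> exists g : vert G -> vert H,
    (forall D, exists K, forall u v,
       vdist R u v <= D -> vdist R (g u) (g v) <= K) /\
    (forall K, exists D, forall u v,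
       vdist R (g u) (g v) <= K -> vdist R u v <= D).
Proof.
move=> [rm [rp [[rm0 rp0] [rmle rple] rmoo fE]]].
pose g v := nearest_vert (f (on_vert R v)); exists g.
have gf v : path_dist (f (on_vert R v)) (on_vert R (g v)) <= 1.
  exact: nearest_vert_dist.
have fE' u v : rm (vdist R u v) <=
    path_dist (f (on_vert R u)) (f (on_vert R v)) <= rp (vdist R u v).
  exact: fE.
split=> [D|K].
  exists (rp D + 2) => u v uv.
  have /andP[_ up] := fE' u v.
  have uD : rp (vdist R u v) <= rp D.
    have uv0 := vdist_ge0 R u v.
    by apply: rple; [exact: uv0|exact: le_trans uv|exact: uv].
  have := path_dist_triangle (f (on_vert R u)) (on_vert R (g u)) (on_vert R (g v)).
  have := path_dist_triangle (f (on_vert R v)) (f (on_vert R u)) (on_vert R (g v)).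
  have := gf u; have := gf v; rewrite (path_dist_sym (f (on_vert R u)) (on_vert R (g u))).
  rewrite /vdist; lra.
(* Beyond [D] the function [rm] exceeds [K + 2], so the rounded images are more than [K] apart. *)
have /cvgryPgt/(_ (K + 2))[D [_ DE]] := rmoo.
exists D => u v uv; rewrite leNgt; apply/negP => /DE /=.
have /andP[low _] := fE' u v.
have := path_dist_triangle (on_vert R (g u)) (f (on_vert R u)) (f (on_vert R v)).
have := path_dist_triangle (on_vert R (g v)) (on_vert R (g u)) (f (on_vert R v)).
have := gf u; have := gf v; rewrite (path_dist_sym (f (on_vert R v)) (on_vert R (g v))).
rewrite /vdist in uv low *; lra.
Qed.

End vertex_maps.

(** * Functions on a glued graph *)

Section glue_functions.
Variables (I : choiceType) (next : I -> I) (G : I -> pgraph).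

(** Evaluation at the chosen representative; independence of the representative requires the values
    to agree at the glued vertices. *)
Definition glue_fun (T : Type) (phi : forall i, vert (G i) -> T)
  (x : glue_vert G) : T := phi (tag (val x)) (tagged (val x)).

Lemma glue_fun_class (T : Type) (phi : forall i, vert (G i) -> T) i
    (v : vert (G i)) :
  (forall j, phi j (qpt (G j)) = phi (next j) (ppt (G (next j)))) ->
  glue_fun phi (glue_class next v) = phi i v.
Proof.
move=> phiq; rewrite /glue_fun /= /glue_repr /glue_rep /=.
by case: eqP => //= ->.
Qed.

Lemma glue_class_tagged (x : glue_vert G) :
  x = glue_class next (tagged (val x)).
Proof.
by case: x => -[i v] vP; apply: val_inj; rewrite /= /glue_repr vP.
Qed.

Lemma glue_fun_lipschitz (R : realType) (i0 : I)
    (reach : forall i, exists k, i = iter k next i0)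
    (phi : forall i, vert (G i) -> R) :
  (forall j, phi j (qpt (G j)) = phi (next j) (ppt (G (next j)))) ->
  (forall i, edge_lipschitz (phi i)) ->
  @edge_lipschitz R (Defs.glue G reach) (glue_fun phi).
Proof.
move=> phiq phiL [i e].
rewrite /= /glue_org /glue_dst !glue_fun_class//=; exact: phiL.
Qed.

End glue_functions.

(** * Separation in the binary tree *)

Section tree.
Variable R : realType.
Implicit Types (p s t u v w : seq bool).
Local Notation tdist := (@vdist R binary_tree).

(** The subtree above [w] can be entered only at [w], which makes [w] a cut vertex. *)
Lemma prefix_rcons_new w s (b : bool) :
  prefix w s != prefix w (rcons s b) -> w = rcons s b.
Proof.
elim: w s => [|a w IH] [|c s] /=; rewrite ?prefix0s ?eqxx//.
- by case: (a =P b) => //= ->; case: w {IH}.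
- by case: (a =P c) => //= -> /IH ->.
Qed.

Lemma tdist_prefix w u v : prefix w u -> ~~ prefix w v -> tdist u w <= tdist u v.
Proof.
move=> wu wv; apply: (@cut1_vdist R binary_tree (prefix w)) wu wv.
by move=> [s b] /= /prefix_rcons_new ->; right.
Qed.

Lemma tdist_size u v : (size v)%:R - (size u)%:R <= tdist u v.
Proof.
apply: (@edge_lipschitz_vdist_le R binary_tree u v (fun s => (size s)%:R)).
move=> [s b] /=; rewrite size_rcons -natr1 ler_norml; apply/andP; lra.
Qed.

Lemma tdist_cat p s : tdist p (p ++ s) <= (size s)%:R.
Proof.
elim/last_ind: s => [|s b IH]; first by rewrite cats0 vdistxx.
rewrite size_rcons -natr1 -rcons_cat.
have := @vdist_triangle R binary_tree (p ++ s) p (rcons (p ++ s) b).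
have := @vdist_edge R binary_tree (p ++ s, b); rewrite /=; lra.
Qed.

Lemma longest_common_prefix u v : exists p u' v', [/\ u = p ++ u', v = p ++ v' &
  forall a, ~~ (prefix [:: a] u' && prefix [:: a] v')].
Proof.
elim: u v => [|a u IH] v; first by exists [::], [::], v.
case: v => [|b v].
  by exists [::], (a :: u), [::]; split=> // c; rewrite andbF.
have [<-|ab] := eqVneq a b; last first.
  exists [::], (a :: u), (b :: v); split=> // c /=; rewrite !prefix0s !andbT.
  by apply/negP => /andP[/eqP ca /eqP cb]; rewrite -ca cb eqxx in ab.
have [p [u' [v' [-> -> h]]]] := IH v.
by exists (a :: p), u', v'; split.
Qed.

(** Take [w] at height n + 1 above the branch point [p], towards [p ++ s]. A path from [w] to
    [p ++ t] must leave the subtree above the first vertex of that branch, n steps below [w]. *)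
Lemma tree_separation_branch p s t (n : nat) :
  (forall a, ~~ (prefix [:: a] s && prefix [:: a] t)) -> (n.+1.*2 <= size s)%N ->
  exists w, [/\ prefix w (p ++ s), ~~ prefix w (p ++ t),
    n%:R <= tdist w (p ++ s) & n%:R <= tdist w (p ++ t)].
Proof.
case: s => [//|a s] st ns; have /= := st a; rewrite eqxx prefix0s /= => at_.
have ns' : (n <= size s)%N by rewrite -addnn /= in ns; lia.
have at' r : ~~ prefix (p ++ a :: r) (p ++ t).
  rewrite prefix_catr// eqxx; apply: contra at_.
  by move=> /prefixP[r' ->] /=; rewrite eqxx prefix0s.
exists (p ++ a :: take n s); split => //.
- by rewrite prefix_catr// eqxx /= eqxx -{2}(cat_take_drop n s) prefix_prefix.
- apply: le_trans (tdist_size _ _); rewrite !size_cat /= size_takel//.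
  rewrite -natrB; last by lia.
  rewrite ler_nat; rewrite -addnn /= in ns; lia.
- apply: (@le_trans _ _ (tdist (p ++ a :: take n s) (p ++ [:: a]))).
    rewrite vdist_sym; apply: le_trans (tdist_size _ _).
    by rewrite !size_cat /= size_takel// -natrB ?ler_nat; lia.
  apply: tdist_prefix (at' _).
  by rewrite prefix_catr// eqxx /= eqxx prefix0s.
Qed.

Lemma tree_separation (K : R) : exists M, forall u v, M < tdist u v ->
  exists w, [/\ prefix w u != prefix w v, K < tdist w u & K < tdist w v].
Proof.
have [n Kn] := exists_nat_gt K.
(* A distance above 4(n + 1) forces one of the branches [s], [t] to have length at least 2(n +
   1). *)
exists ((n.+1.*2).*2)%:R => u v.
have [p [s [t [-> -> st]]]] := longest_common_prefix u v => lt.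
have : ((n.+1.*2).*2 < size s + size t)%N.
  rewrite -(ltr_nat R) natrD; apply: lt_le_trans lt _.
  have := @vdist_triangle R binary_tree p (p ++ s) (p ++ t).
  have := tdist_cat p s; have := tdist_cat p t.
  rewrite (@vdist_sym R binary_tree (p ++ s) p); lra.
have [ns _|sn nt] := leqP n.+1.*2 (size s).
  have [w [wu wv h1 h2]] := tree_separation_branch p st ns.
  by exists w; rewrite wu (negbTE wv); split => //; apply: lt_le_trans Kn _.
have ns : (n.+1.*2 <= size t)%N by lia.
have ts a : ~~ (prefix [:: a] t && prefix [:: a] s) by rewrite andbC.
have [w [wu wv h1 h2]] := tree_separation_branch p ts ns.
by exists w; rewrite wu (negbTE wv); split => //; apply: lt_le_trans Kn _.
Qed.

(** The words starting with [true] are cut off by the root; the default [false] of [head] leaves the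
    root itself outside. *)
Lemma tdist_rays i j :
  tdist (nseq j true) [::] <= tdist (nseq i false) (nseq j true).
Proof.
case: j => [|j]; first by rewrite vdistxx vdist_ge0.
rewrite (@vdist_sym R binary_tree (nseq i false)).
apply: (@cut1_vdist R binary_tree (head false)) => //; last by case: i.
by move=> [[|a s] b] /=; [left|rewrite eqxx].
Qed.

End tree.

(** * Potentials and finiteness of the graphs Gamma_n *)

Section Gamma_structure.
Variable R : realType.

(** The potential climbs from 0 to 2^(n+1) along copies 0 and 1 and descends along copies 2 and 3.
    It bounds from below the distance between primary vertices. *)
Lemma Gamma_n_potential (n : nat) : exists phi : vert (Gamma_ n) -> R,
  [/\ edge_lipschitz phi, phi (ppt _) = 0 & phi (qpt _) = 2 ^+ n].
Proof.
elim: n => [|n [phi [phiL phip phiq]]].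
  exists (fun b : bool => b%:R); split=> // e /=.
  by rewrite sub0r normrN1.
pose psi (i : 'I_4) (v : vert (Gamma_ n)) : R :=
  match val i with
  | 0%N => phi v | 1%N => 2 ^+ n + phi v
  | 2%N => 2 ^+ n + 2 ^+ n - phi v | _ => 2 ^+ n - phi v end.
have psiq i : psi i (qpt (Gamma_ n)) = psi (ordS i) (ppt (Gamma_ n)).
  by case: i => -[|[|[|[|]]]]// lti; rewrite /psi /= phip phiq; lra.
have psiE i v : glue_fun (G := fun=> Gamma_ n) psi
    (glue_class (@ordS 4) (G := fun=> Gamma_ n) (i := i) v) = psi i v.
  exact: (glue_fun_class (next := @ordS 4)).
exists (glue_fun (G := fun=> Gamma_ n) psi); split.
- apply: glue_fun_lipschitz => // i e; have := phiL e.
  rewrite !ler_norml => /andP[? ?].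
  by case: i => -[|[|[|[|]]]]// lti; rewrite /psi /=; apply/andP; lra.
- by rewrite /= /four_cycle_pt psiE.
- by rewrite /= /four_cycle_pt psiE /psi /= phip exprS; lra.
Qed.

Lemma Gamma_n_finite (n : nat) :
  exists s : seq (vert (Gamma_ n)), forall v, v \in s.
Proof.
elim: n => [|n [s sE]]; first by exists [:: false; true]; case.
exists [seq glue_class (@ordS 4) (G := fun=> Gamma_ n) (i := i) v
         | i <- enum 'I_4, v <- s] => x.
rewrite [x](glue_class_tagged (@ordS 4)).
by apply: allpairs_f => //; rewrite mem_enum.
Qed.

(** * The chain of pieces and its cut vertices *)

(* The image in [Gamma_graph] of the vertex [v] of the [n]-th piece, which is
   the graph Gamma_(n+1). *)
Definition chain_pt (n : nat) (v : vert (Gamma_ n.+1)) : vert Gamma_graph :=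
  glue_class succn (G := fun n => Gamma_ n.+1) (i := n) v.

(** A gluing vertex counts as belonging to the later of its two pieces. *)
Definition chain_tag (x : vert Gamma_graph) : nat := tag (val x).

Local Notation gdist := (@vdist R Gamma_graph).

Lemma chain_tag_pt n (v : vert (Gamma_ n.+1)) :
  chain_tag (chain_pt v) = if v == qpt _ then n.+1 else n.
Proof.
by rewrite /chain_tag /= /glue_repr /glue_rep /=; case: eqP.
Qed.

Lemma chain_tag_gdist x y : (chain_tag y)%:R - (chain_tag x)%:R <= gdist x y.
Proof.
apply: (@edge_lipschitz_vdist_le R Gamma_graph x y (fun x => (chain_tag x)%:R)).
move=> [n e]; change (`|(chain_tag (chain_pt (org e)))%:R -
  (chain_tag (chain_pt (dst e)))%:R| <= 1 :> R).
by rewrite !chain_tag_pt; case: eqP; case: eqP => _ _;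
  rewrite -?natr1 ler_norml; apply/andP; lra.
Qed.

Lemma chain_tag_bounded x (n : nat) :
  exists B, forall y, (chain_tag y <= n)%N -> gdist x y <= B.
Proof.
have piece k : exists B, forall v : vert (Gamma_ k.+1), gdist x (chain_pt v) <= B.
  have [s sE] := Gamma_n_finite k.+1.
  (* The sum of all distances to the finite piece is a crude bound for each of them. *)
  exists (\sum_(v <- s) gdist x (chain_pt v)) => v.
  rewrite (big_rem v) //= lerDl sumr_ge0 // => w _; exact: vdist_ge0.
have tagE k y : chain_tag y = k -> exists v : vert (Gamma_ k.+1), y = chain_pt v.
  by move=> <-; exists (tagged (val y)); exact: (glue_class_tagged succn).
elim: n => [|n [B BE]].
  have [B BE] := piece 0%N; exists B => y.
  by rewrite leqn0 => /eqP/tagE[v ->].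
have [B' BE'] := piece n.+1; exists (Num.max B B') => y.
rewrite leq_eqVlt ltnS le_max => /orP[/eqP/tagE[v ->]|/BE ->//].
by rewrite BE' orbT.
Qed.

Lemma chain_cut (n : nat) x y : (chain_tag x <= n < chain_tag y)%N ->
  gdist x (chain_pt (qpt (Gamma_ n.+1))) <= gdist x y.
Proof.
move=> /andP[xn ny].
apply: (@cut1_vdist R Gamma_graph (fun x => chain_tag x <= n)%N) => //; last first.
  by rewrite -ltnNge.
move=> [k e].
change ((chain_tag (chain_pt (org e)) <= n)%N != (chain_tag (chain_pt (dst e)) <= n)%N ->
  chain_pt (org e) = chain_pt (qpt (Gamma_ n.+1)) \/
  chain_pt (dst e) = chain_pt (qpt (Gamma_ n.+1))).
(* An edge of piece [k] has tags in {k, k + 1}, and only [qpt] has tag k + 1; hence level [n] is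
   crossed only at the [qpt] of piece [n]. *)
rewrite !chain_tag_pt; have [->|_] := eqVneq (org e) (qpt _);
  have [->|_] := eqVneq (dst e) (qpt _); rewrite ?eqxx// => h.
- by left; have -> : k = n by case: ltngtP h => //; case: ltngtP.
- by right; have -> : k = n by case: ltngtP h => //; case: ltngtP.
Qed.

(** * The two halves of a piece *)

Definition cycle_pt (n : nat) (i : 'I_4) (v : vert (Gamma_ n)) :
    vert (Gamma_ n.+1) :=
  glue_class (@ordS 4) (G := fun=> Gamma_ n) (i := i) v.

Lemma cycle_pt_qpt n i : cycle_pt i (qpt (Gamma_ n)) = cycle_pt (ordS i) (ppt _).
Proof. exact: glue_class_qpt. Qed.

(** Excluding [p_0] and [q_1 = p_2] makes the values agree at the glued vertices with [false] on
    copies 2 and 3. *)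
Definition half_copy n (i : 'I_4) (v : vert (Gamma_ n)) : bool :=
  match val i with 0%N => v != ppt _ | 1%N => v != qpt _ | _ => false end.

(* The copies 0 and 1 of Gamma_n in Gamma_(n+1), without the two primary
   vertices p_0 and p_2. *)
Definition half_cycle n : pred (vert (Gamma_ n.+1)) :=
  glue_fun (G := fun=> Gamma_ n) (@half_copy n).

Lemma half_cycle_pt n i (v : vert (Gamma_ n)) :
  half_cycle (cycle_pt i v) = half_copy i v.
Proof.
apply: (glue_fun_class (next := @ordS 4)) => -[[|[|[|[|]]]]//= lti];
  by rewrite /half_copy /= ?eqxx// ppt_neq_qpt// eq_sym ppt_neq_qpt.
Qed.

Definition half_chain n : pred (vert Gamma_graph) :=
  glue_fun (G := fun k => Gamma_ k.+1) (fun k v => (k == n) && half_cycle v).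

Lemma half_chain_pt n k (v : vert (Gamma_ k.+1)) :
  half_chain n (chain_pt v) = (k == n) && half_cycle v.
Proof.
have hp j : half_cycle (ppt (Gamma_ j.+1)) = false.
  by apply: etrans (half_cycle_pt i0_4 (ppt _)) _; rewrite /half_copy /= eqxx.
have hq j : half_cycle (qpt (Gamma_ j.+1)) = false.
  exact: (half_cycle_pt i2_4 (ppt _)).
by apply: (glue_fun_class (next := succn)) => j; rewrite hp hq !andbF.
Qed.

(** Every boundary edge of the half meets [p_0] in copy 0 or [q_1 = p_2] in copy 1. *)
Lemma half_chain_cut n x y : half_chain n x -> ~~ half_chain n y ->
  gdist x (chain_pt (ppt (Gamma_ n.+1))) <= gdist x y \/
  gdist x (chain_pt (qpt (Gamma_ n.+1))) <= gdist x y.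
Proof.
apply: cut_vdist => -[k [i e]].
change (half_chain n (chain_pt (cycle_pt i (org e))) !=
        half_chain n (chain_pt (cycle_pt i (dst e))) ->
  [\/ chain_pt (cycle_pt i (org e)) = chain_pt (ppt (Gamma_ n.+1)),
      chain_pt (cycle_pt i (org e)) = chain_pt (qpt (Gamma_ n.+1)),
      chain_pt (cycle_pt i (dst e)) = chain_pt (ppt (Gamma_ n.+1)) |
      chain_pt (cycle_pt i (dst e)) = chain_pt (qpt (Gamma_ n.+1))]).
rewrite !half_chain_pt !half_cycle_pt.
case: (k =P n) e => [-> e|_ e] /=; last by [].
have p0 (j : 'I_4) : val j = 0%N -> cycle_pt j (ppt _) = ppt (Gamma_ n.+1).
  by move=> j0; congr cycle_pt; exact: val_inj.
have q1 (j : 'I_4) : val j = 1%N -> cycle_pt j (qpt _) = qpt (Gamma_ n.+1).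
  move=> j1; rewrite cycle_pt_qpt; congr cycle_pt; apply: val_inj.
  by rewrite /= j1.
rewrite /half_copy; case: i {e} (p0 i) (q1 i) e => -[|[|i]] lti /= p q e.
- have [->|_] := eqVneq (org e) (ppt _).
    by move=> _; apply: Or41; rewrite p.
  have [->|_] := eqVneq (dst e) (ppt _); last by [].
  by move=> _; apply: Or43; rewrite p.
- have [->|_] := eqVneq (org e) (qpt _).
    by move=> _; apply: Or42; rewrite q.
  have [->|_] := eqVneq (dst e) (qpt _); last by [].
  by move=> _; apply: Or44; rewrite q.
- by [].
Qed.

Lemma copy_cross n (i : 'I_4) (Q : pred (vert Gamma_graph)) :
  Q (chain_pt (cycle_pt i (ppt (Gamma_ n)))) !=
  Q (chain_pt (cycle_pt i (qpt (Gamma_ n)))) ->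
  exists u v : vert (Gamma_ n), let x := chain_pt (cycle_pt i u) in
    let y := chain_pt (cycle_pt i v) in [/\ Q x, ~~ Q y & gdist x y <= 1].
Proof.
move=> /(@linked_cross _ _ _ _ (fun v => Q (chain_pt (cycle_pt i v))) _ _
  (graph_connected _ _))[e].
have e1 : gdist (chain_pt (cycle_pt i (org e))) (chain_pt (cycle_pt i (dst e))) <= 1.
  exact: (@vdist_edge R Gamma_graph (Tagged (fun k => edge (Gamma_ k.+1))
    (Tagged (fun _ : 'I_4 => edge (Gamma_ n)) e : edge (Gamma_ n.+1)))).
have [Qo|Qo] := boolP (Q (chain_pt (cycle_pt i (org e)))) => /= Qd.
  by exists (org e), (dst e); split => //; case: (Q _) Qd.
exists (dst e), (org e); split => //; first by case: (Q _) Qd.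
by rewrite vdist_sym.
Qed.

(** Since [q_i = p_(i+1)], a change of [Q] over two consecutive copies occurs within one of them. *)
Lemma two_copies_cross n (i j : 'I_4) (Q : pred (vert Gamma_graph)) :
  j = ordS i ->
  Q (chain_pt (cycle_pt i (ppt (Gamma_ n)))) !=
  Q (chain_pt (cycle_pt j (qpt (Gamma_ n)))) ->
  exists k (u v : vert (Gamma_ n)), let x := chain_pt (cycle_pt k u) in
    let y := chain_pt (cycle_pt k v) in
    [/\ k = i \/ k = j, Q x, ~~ Q y & gdist x y <= 1].
Proof.
move=> -> Qij.
have [/copy_cross[u [v [? ? ?]]]|/negPn/eqP Qi] :=
    boolP (Q (chain_pt (cycle_pt i (ppt (Gamma_ n)))) !=
           Q (chain_pt (cycle_pt i (qpt (Gamma_ n))))).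
  by exists i, u, v; split => //; left.
move: Qij; rewrite Qi cycle_pt_qpt => /copy_cross[u [v [? ? ?]]].
by exists (ordS i), u, v; split => //; right.
Qed.

(** Copies 0 and 1 lead from [a] to [c], copies 2 and 3 back. The first crossing may start at [a] or
    [c], which lie outside the open half. *)
Lemma halves_cross n (Q : pred (vert Gamma_graph)) :
  let a := chain_pt (ppt (Gamma_ n.+1)) in
  let c := chain_pt (qpt (Gamma_ n.+1)) in
  Q a != Q c ->
  (exists x y, [/\ half_chain n x \/ x = a \/ x = c, Q x, ~~ Q y & gdist x y <= 1])
  /\ (exists x y, [/\ ~~ half_chain n x, Q x, ~~ Q y & gdist x y <= 1]).
Proof.
move=> a c Qac; pose o k (lt : (k < 4)%N) : 'I_4 := Ordinal lt.
have aE : a = chain_pt (cycle_pt (@o 0%N isT) (ppt (Gamma_ n))).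
  by congr (chain_pt (cycle_pt _ _)); apply: val_inj.
have aE' : a = chain_pt (cycle_pt (@o 3%N isT) (qpt (Gamma_ n))).
  by rewrite cycle_pt_qpt; congr (chain_pt (cycle_pt _ _)); apply: val_inj.
have cE : c = chain_pt (cycle_pt (@o 1%N isT) (qpt (Gamma_ n))).
  by rewrite cycle_pt_qpt; congr (chain_pt (cycle_pt _ _)); apply: val_inj.
have cE' : c = chain_pt (cycle_pt (@o 2%N isT) (ppt (Gamma_ n))).
  by congr (chain_pt (cycle_pt _ _)); apply: val_inj.
split.
- have [||k [u [v [ki Qu Qv uv]]]] :=
    @two_copies_cross n (@o 0%N isT) (@o 1%N isT) Q.
  + exact: val_inj.
  + by rewrite -aE -cE.
  exists (chain_pt (cycle_pt k u)), (chain_pt (cycle_pt k v)); split => //.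
  rewrite half_chain_pt eqxx half_cycle_pt.
  case: ki {Qu uv} => ->; rewrite /half_copy /=.
    by case: eqVneq => [->|_]; [right; left|left].
  by case: eqVneq => [->|_]; [right; right|left].
- have [||k [u [v [ki Qu Qv uv]]]] :=
    @two_copies_cross n (@o 2%N isT) (@o 3%N isT) Q.
  + exact: val_inj.
  + by rewrite -aE' -cE' eq_sym.
  exists (chain_pt (cycle_pt k u)), (chain_pt (cycle_pt k v)); split => //.
  rewrite half_chain_pt eqxx half_cycle_pt.
  by case: ki {Qu uv} => ->.
Qed.

Lemma gdist_primary n :
  2 ^+ n.+1 <= gdist (chain_pt (ppt (Gamma_ n.+1))) (chain_pt (qpt (Gamma_ n.+1))).
Proof.
have [phi phiP] : exists phi : forall k, vert (Gamma_ k) -> R, forall k,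
    [/\ edge_lipschitz (phi k), phi k (ppt _) = 0 & phi k (qpt _) = 2 ^+ k].
  by exists (fun k => projT1 (cid (Gamma_n_potential k))) => k; case: cid.
(* Adding the heights of all earlier pieces makes the potentials match at the gluing vertices. *)
pose psi k (v : vert (Gamma_ k.+1)) : R := \sum_(j < k) 2 ^+ j.+1 + phi k.+1 v.
have psiq k : psi k (qpt (Gamma_ k.+1)) = psi k.+1 (ppt (Gamma_ k.+2)).
  have [_ _ phiq] := phiP k.+1; have [_ phip _] := phiP k.+2.
  by rewrite /psi phiq phip addr0 big_ord_recr.
have psiE k (v : vert (Gamma_ k.+1)) :
    glue_fun (G := fun k => Gamma_ k.+1) psi (chain_pt v) = psi k v.
  exact: (glue_fun_class (next := succn)).
have := @edge_lipschitz_vdist_le R Gamma_graph (chain_pt (ppt (Gamma_ n.+1)))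
  (chain_pt (qpt (Gamma_ n.+1))) (glue_fun (G := fun k => Gamma_ k.+1) psi).
have [_ phip phiq] := phiP n.+1.
rewrite !psiE /psi phip phiq addr0 addrC addKr; apply.
apply: glue_fun_lipschitz => // k e; have [phiL _ _] := phiP k.+1.
by rewrite /psi opprD addrACA subrr add0r; exact: phiL.
Qed.

End Gamma_structure.

(** * The two impossibility statements *)

Lemma tree_not_coarse_in_Gamma (R : realType) :
  ~ exists f : Tbar R -> Gamma R, coarse_embedding f.
Proof.
move=> [f /coarse_embedding_vert[g [gup glow]]].
(* [C] bounds the jump of [g] along an edge, [D] the distance of vertices with images within 2C, [K]
   the distance of images of vertices within [D]. *)
have [C CE] := gup 1; have [D DE] := glow (C + C); have [K KE] := gup D.
pose o := g [::].
have [n0 n0E] := exists_nat_gt (C + K).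
(* The tag of [q] exceeds that of [o] by n0 + 1, hence by more than C + K. *)
pose n := (n0 + chain_tag o)%N.
pose q := chain_pt (qpt (Gamma_ n.+1)).
have ray b : exists i, vdist R (g (nseq i b)) q <= C.
  have [B BE] := chain_tag_bounded R o n; have [D' DE'] := glow B.
  have [i0 i0E] := exists_nat_gt D'.
  (* Images with tag at most [n] lie within [B] of [o], so their preimages lie within [D'] of the
     root; the ray eventually passes [q]. *)
  have far : (n < chain_tag (g (nseq i0 b)))%N.
    rewrite ltnNge; apply/negP => /BE /DE'.
    have := tdist_size R [::] (nseq i0 b); rewrite size_nseq /=; lra.
  (* The image of the root has tag at most [n], so somewhere a single step of the ray jumps over
     [q]. *)
  have [i [lei lti]] : exists i, (chain_tag (g (nseq i b)) <= n)%N /\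
                                 (n < chain_tag (g (nseq i.+1 b)))%N.
    elim: i0 far {i0E} => [|i IH] far; first by move: far; rewrite /= -/o /n; lia.
    by case: (leqP (chain_tag (g (nseq i b))) n) => [h|/IH//]; exists i.
  exists i; apply: (@le_trans _ _ (vdist R (g (nseq i b)) (g (nseq i.+1 b)))).
    by apply: chain_cut; rewrite lei lti.
  apply: CE; have := @vdist_edge R binary_tree (nseq i b, b).
  by rewrite /= -cats1 -[[:: b]]/(nseq 1 b) -nseqD addn1.
have [i iE] := ray false; have [j jE] := ray true.
have : vdist R (g (nseq i false)) (g (nseq j true)) <= C + C.
  have := vdist_triangle R q (g (nseq i false)) (g (nseq j true)).
  by rewrite (vdist_sym R q); lra.
move=> /DE ijD.
(* The ray vertex is at least as close to the root as to the other ray, so its image is within [K]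
   of [o] and within [C] of [q]. *)
have /KE jK : @vdist R binary_tree (nseq j true) [::] <= D.
  exact: le_trans (tdist_rays _ _ _) ijD.
have := vdist_triangle R (g (nseq j true)) o q.
rewrite (vdist_sym R o (g (nseq j true))); have := chain_tag_gdist R o q.
have -> : chain_tag q = n.+1 by rewrite chain_tag_pt eqxx.
rewrite -natr1 natrD; move: jK; rewrite -/o; lra.
Qed.

Lemma Gamma_not_coarse_in_tree (R : realType) :
  ~ exists f : Gamma R -> Tbar R, coarse_embedding f.
Proof.
move=> [f /coarse_embedding_vert[g [gup glow]]].
have [C CE] := gup 1; have [D DE] := glow (C + C); have [K KE] := gup D.
(* The margin C + K contradicts the final bound on the distance from [w] to [g a] or [g c]; [n]
   above [D'] puts these images more than [M] apart. *)
have [M ME] := tree_separation (C + K); have [D' DE'] := glow M.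
have [n nE] := exists_nat_gt D'.
pose a := chain_pt (ppt (Gamma_ n.+1)); pose c := chain_pt (qpt (Gamma_ n.+1)).
have [|w [wac aw cw]] := ME (g a) (g c).
  rewrite ltNge; apply/negP => /DE'; apply/negP; rewrite -ltNge.
  apply: lt_le_trans (gdist_primary R n); apply: lt_trans nE _.
  by rewrite -natrX ltr_nat (ltn_trans (ltnSn n))// ltn_expl.
(* An edge whose image enters the subtree above [w] has its inner end sent within [C] of the cut
   vertex [w]. *)
have near x y : prefix w (g x) -> ~~ prefix w (g y) ->
    @vdist R Gamma_graph x y <= 1 -> @vdist R binary_tree (g x) w <= C.
  by move=> wx wy /CE; apply: le_trans; exact: tdist_prefix.
have [[x [x' [xH wx wx' /(near _ _ wx wx') xw]]]
      [y [y' [yH wy wy' /(near _ _ wy wy') yw]]]] :=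
  @halves_cross R n (fun z => prefix w (g z)) wac.
have /DE xyD : @vdist R binary_tree (g x) (g y) <= C + C.
  have := @vdist_triangle R binary_tree w (g x) (g y).
  by rewrite (@vdist_sym R binary_tree w (g y)); lra.
have D0 : 0 <= D by apply: le_trans xyD; exact: vdist_ge0.
(* Either [x] is [a] or [c], or the open half containing [x] but not [y] is cut off by [a] and
   [c]. *)
have : vdist R x a <= D \/ vdist R x c <= D.
  case: xH => [xH|[->|->]]; rewrite ?vdistxx; [|by left|by right].
  have [h|h] := @half_chain_cut R n x y xH yH; [left|right];
    exact: le_trans h xyD.
have tri z := @vdist_triangle R binary_tree (g x) w (g z).
rewrite (@vdist_sym R binary_tree w (g x)) in tri.
case=> /KE; [have := tri a|have := tri c]; lra.
Qed.

Theorem proposition8 (R : realType) :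
  ~ (exists f : Tbar R -> Gamma R, coarse_embedding f) /\
  ~ (exists f : Gamma R -> Tbar R, coarse_embedding f).
Proof.
by split; [exact: tree_not_coarse_in_Gamma|exact: Gamma_not_coarse_in_tree].
Qed.
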